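(* Let $n\ge 2$ and let $\alpha\in A_n$ be any element. Starting from $\alpha$, repeatedly apply the elementary operation ($\mathcal{E}_s$ or $\mathcal{E}_c$) on the tail of the longest left sequence of even length of the current sequence, until the maximal element $(n)$ of $A_n$ is obtained. Starting again from $\alpha$, repeatedly apply the elementary operation ($\mathcal{E}_s$ or $\mathcal{E}_c$) on the tail of the longest left sequence of odd length of the current sequence, until the minimal element $(1,n-1)$ of $A_n$ is obtained. Then this procedure terminates and produces all elements of $A_n$: the first iteration produces, in increasing order, all successors of $\alpha$ in $A_n$, the second produces, in decreasing order, all precedings of $\alpha$ in $A_n$, and each element produced is adjacent in $A_n$ to the one produced just before it.
   Context: An $\alpha$-sequence is a finite sequence $\alpha=(\alpha_1,\dots,\alpha_k)$ of positive integers. $A_n$ is the set of all such sequences with $\sum_{i=1}^k\alpha_i=n$ ($1\le k\le n$). A left sequence of $\alpha$ is $(\alpha_1,\dots,\alpha_i)$, $1\le i\le k$, and its tail is $\alpha_i$. Order. For $\tau=(\tau_1,\dots,\tau_k)$ put $Al(\tau)=(\tau_1,-\tau_2,\tau_3,\dots,(-1)^{k-1}\tau_k,0,0,\dots)$. For $\tau\ne\tau'$ write $\tau>\tau'$ if the first nonzero term of $Al(\tau)-Al(\tau')$ is positive, and $\tau<\tau'$ if it is negative. This is a total order. If $\alpha<\beta$, $\beta$ is called a successor of $\alpha$ and $\alpha$ a preceding of $\beta$. Two elements $\alpha<\beta$ of a set $S$ are adjacent in $S$ if there is no $\gamma\in S$ with $\alpha<\gamma<\beta$. Elementary operations. The $i$-th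 place of $\alpha$ is called its $i$-th cell, with value $\alpha_i$. The elementary operation on cell $i$ is: if $\alpha_i>1$, splitting $\mathcal{E}_s$, which gives $(\alpha_1,\dots,\alpha_{i-1},\alpha_i-1,1,\alpha_{i+1},\dots,\alpha_k)$; if $\alpha_i=1$ (and $i\ge2$), conjugation $\mathcal{E}_c$, which gives $(\alpha_1,\dots,\alpha_{i-2},\alpha_{i-1}+1,\alpha_{i+1},\dots,\alpha_k)$. *)

(* Defs.v *)
From mathcomp Require Import all_boot all_order all_algebra.
From Stdlib Require Export Sorted.

Set Implicit Arguments.
Unset Strict Implicit.
Unset Printing Implicit Defensive.

Import GRing.Theory Num.Theory.

Definition alpha_seq (s : seq nat) : bool := (s != [::]) && all (leq 1) s.

Definition A (n : nat) : {pred seq nat} :=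
  [pred s | alpha_seq s & sumn s == n].

(* Indices start at 0 here, so the sign (-1)^(i-1) of the i-th term, i >= 1,
   becomes (-1)^i. *)
Definition Al (s : seq nat) (i : nat) : int :=
  ((-1) ^+ i * (nth 0%N s i)%:Z)%R.

(* The first nonzero term of Al s - Al t exists and is negative; in particular
   s and t are distinct. *)
Definition alpha_lt (s t : seq nat) : Prop :=
  exists i : nat,
    (forall j : nat, j < i -> (Al s j - Al t j = 0)%R) /\
    (Al s i - Al t i < 0)%R.

Definition alpha_gt (s t : seq nat) : Prop := alpha_lt t s.

(* The relation is oriented: s is the smaller of the two adjacent elements. *)
Definition adjacent (S : {pred seq nat}) (s t : seq nat) : Prop :=
  [/\ s \in S, t \in S, alpha_lt s t &
      ~ exists u : seq nat, [/\ u \in S, alpha_lt s u & alpha_lt u t]].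

(* Cells are numbered from 1. *)
Definition cell (s : seq nat) (i : nat) : nat := nth 0 s i.-1.

Definition splitting (i : nat) (s : seq nat) : seq nat :=
  take i.-1 s ++ [:: (cell s i).-1; 1] ++ drop i s.

Definition conjugation (i : nat) (s : seq nat) : seq nat :=
  take i.-2 s ++ [:: (cell s i.-1).+1] ++ drop i s.

(* None when there is no i-th cell, or when i = 1 and the first cell has
   value 1. *)
Definition elementary_op (i : nat) (s : seq nat) : option (seq nat) :=
  if ~~ (1 <= i <= size s) then None
  else if 1 < cell s i then Some (splitting i s)
  else if (cell s i == 1) && (2 <= i) then Some (conjugation i s)
  else None.

Definition left_seqs (s : seq nat) : seq (seq nat) :=
  [seq take i s | i <- iota 1 (size s)].

(* The length of the longest left sequence of odd (b = true) or even (b = false)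
   length, which is also the position in s of its tail; it is 0, hence not a
   cell, when no left sequence has that parity. *)
Definition longest_left (b : bool) (s : seq nat) : nat :=
  \max_(l <- left_seqs s | odd (size l) == b) size l.

Definition step (b : bool) (s : seq nat) : option (seq nat) :=
  elementary_op (longest_left b s) s.

(* [produces f stop x r]: starting from x and applying f until stop is first
   reached, the successive values obtained after x are those listed in r, and f
   is defined at each stage. Such an r is unique, and it exists exactly when the
   iteration reaches stop after finitely many applications. *)
Inductive produces (f : seq nat -> option (seq nat)) (stop : seq nat) :
    seq nat -> seq (seq nat) -> Prop :=
  | produces_stop : produces f stop stop [::]
  | produces_step (x y : seq nat) (r : seq (seq nat)) :
      x <> stop -> f x = Some y -> produces f stop y r ->
      produces f stop x (y :: r).

(* Main.v *)
Require Import Defs.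
From mathcomp Require Import all_boot all_order all_algebra.
From mathcomp Require Import zify.

(* Because the signs of Al alternate, comparing x :: s with x :: t is comparing
   t with s. Likewise the step in one direction at x :: s is the step in the
   opposite direction at s, as long as the latter exists; it fails only when s
   is empty or extremal, and then the step acts on x, leaving a remainder which
   is again extremal. By induction each step yields the immediate neighbour in
   its direction, and finiteness of A n gives termination. *)

Set Implicit Arguments.
Unset Strict Implicit.
Unset Printing Implicit Defensive.

Import GRing.Theory.

(** * The alternating order on sequences *)

Lemma alpha_lt_irr s : ~ alpha_lt s s.
Proof. by case=> i []; lia. Qed.

Lemma alpha_lt_trans s t u : alpha_lt s t -> alpha_lt t u -> alpha_lt s u.
Proof.
case=> i [eq_i lt_i] [j [eq_j lt_j]].
(* Before [minn i j] both pairs agree; at that place at least one difference is negative and neither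
   is positive. *)
exists (minn i j); split=> [k lt_k|].
  have lt_ki : k < i by lia.
  have lt_kj : k < j by lia.
  by have := eq_i k lt_ki; have := eq_j k lt_kj; lia.
have [lt_ij|lt_ji|eq_ij] := ltngtP i j.
- by have := eq_j i lt_ij; lia.
- by have := eq_i j lt_ji; lia.
- by subst j; lia.
Qed.

Lemma Al_cons0 x s : Al (x :: s) 0 = (x%:Z)%R.
Proof. by rewrite /Al expr0 mul1r. Qed.

Lemma Al_consS x s i : Al (x :: s) i.+1 = (- Al s i)%R.
Proof. by rewrite /Al exprS mulN1r mulNr. Qed.

Lemma alpha_lt_head x y s t : x < y -> alpha_lt (x :: s) (y :: t).
Proof. by move=> lt_xy; exists 0; split=> //; rewrite !Al_cons0; lia. Qed.

Lemma alpha_lt_cons x s t : alpha_lt t s -> alpha_lt (x :: s) (x :: t).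
Proof.
case=> i [eq_i lt_i]; exists i.+1; split=> [[|j] lt_j|].
- by rewrite !Al_cons0; lia.
- by have := eq_i j lt_j; rewrite !Al_consS; lia.
- by rewrite !Al_consS; lia.
Qed.

(** Equal sums of positive entries prevent one list from running out before the other, so the first
    differing entries decide. Below a common head the two strict outcomes trade places. *)
Lemma alpha_lt_total s t : all (leq 1) s -> all (leq 1) t -> sumn s = sumn t ->
  [\/ s = t, alpha_lt s t | alpha_lt t s].
Proof.
elim: s t => [|x s IHs] [|y t] /=; try lia; first by constructor 1.
move=> /andP[x_gt0 s_pos] /andP[y_gt0 t_pos] eq_sum.
have [lt_xy|lt_yx|eq_xy] := ltngtP x y.
- by constructor 2; apply: alpha_lt_head.
- by constructor 3; apply: alpha_lt_head.
subst y; have [->|lt_st|lt_ts] := IHs t s_pos t_pos (addnI eq_sum).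
- by constructor 1.
- by constructor 3; apply: alpha_lt_cons.
- by constructor 2; apply: alpha_lt_cons.
Qed.

(** [t] lies ahead of [s] for the iteration of [step b], which descends when [b] is [true]. Keeping
    the direction as a parameter lets one induction serve both iterations, since passing to a tail
    flips it. *)
Definition dir_lt (b : bool) (s t : seq nat) : Prop :=
  if b then alpha_lt t s else alpha_lt s t.

Lemma dir_lt_irr b s : ~ dir_lt b s s.
Proof. by case: b; apply: alpha_lt_irr. Qed.

Lemma dir_lt_trans b s t u : dir_lt b s t -> dir_lt b t u -> dir_lt b s u.
Proof.
case: b => /= [ts ut|]; [exact: alpha_lt_trans ut ts|exact: alpha_lt_trans].
Qed.

Lemma dir_lt_cons b x s t : dir_lt (~~ b) s t -> dir_lt b (x :: s) (x :: t).
Proof. by case: b => /=; apply: alpha_lt_cons. Qed.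

(** * The cell acted on, and the step on a tail *)

Lemma longest_leftE b s :
  longest_left b s = if odd (size s) == b then size s else (size s).-1.
Proof.
(* Of the lengths [size s] and [(size s).-1] one has parity [b]. When no left sequence has that
   parity, the formula gives [0], as the empty maximum does. *)
apply/eqP; rewrite eqn_leq; apply/andP; split.
  apply/bigmax_leqP_seq => l /mapP[i]; rewrite mem_iota => i_in -> .
  rewrite size_takel; last lia.
  case: ifP => [|neq_b eq_b]; first lia.
  by have [eq_i|] := eqVneq i (size s); [move: eq_b; rewrite eq_i neq_b|lia].
set m := (X in X <= _).
have [->//|m_gt0] := posnP m.
have le_m : m <= size s by rewrite /m; case: ifP; lia.
have <- : size (take m s) = m by rewrite size_takel.
apply: (@leq_bigmax_seq _ _ (fun l => odd (size l) == b) size).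
  by apply/mapP; exists m; rewrite ?mem_iota //; lia.
move: m_gt0; rewrite size_takel // /m {m le_m}.
by case: ifP; case: (size s) => [|k] //=; case: b; case: (odd k).
Qed.

(** A new head shifts positions by one and flips their parity. The empty [s] is excluded because,
    for [b = false], the one-cell list has no even cell: the left side would be [0] and the right
    side [1]. *)
Lemma longest_left_cons b x s : s != [::] ->
  longest_left b (x :: s) = (longest_left (~~ b) s).+1.
Proof.
rewrite !longest_leftE /=; case: s => //= y s _.
by case: b; case: (odd (size s)).
Qed.

Lemma step_cons b x s t :
  step (~~ b) s = Some t -> step b (x :: s) = Some (x :: t).
Proof.
rewrite /step; have [->|s_neq0] := eqVneq s [::].
  by rewrite longest_leftE /=; case: b.
rewrite longest_left_cons // /elementary_op.
case: (longest_left (~~ b) s) => [|i] //=; rewrite ltnS /cell /=.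
case: ifP => //= lt_i; case: ifP => [_ [<-] //|_].
(* For [i = 0] the cell is the first of [s]. Conjugating it is undefined in [s], hence ruled out by
   hypothesis, whereas in [x :: s] it would merge the cell into [x]. *)
by case: i lt_i => [|i] _; rewrite ?andbF //; case: ifP => //= _ [<-].
Qed.

(** With three or more entries the chosen cell has position at least 2 and a positive value, so
    splitting or conjugation applies. Shorter lists are inspected one by one. *)
Lemma step_eq_None b s : all (leq 1) s -> step b s = None ->
  if b then [\/ s = [::], s = [:: 1] | exists2 m, 0 < m & s = [:: 1; m]]
  else s = [::] \/ exists m, s = [:: m].
Proof.
rewrite /step longest_leftE.
case: s => [|x [|y [|z s]]]; first by case: b => //=; [constructor 1|left].
- rewrite /elementary_op /cell; case: b => /= [|_ _]; last by right; exists x.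
  by case: x => [|[|x]] //= _ _; constructor 2.
- rewrite /elementary_op /cell; case: b => /= => [|].
    by case: x => [|[|x]] //= y_gt0 _; constructor 3; exists y => //; lia.
  by case: y => [|[|y]]; rewrite ?andbF.
move=> s_pos; set m := (X in elementary_op X _).
have /andP[m_gt1 le_m] : 2 <= m <= size [:: x, y, z & s].
  by rewrite /m; case: ifP => _ /=; lia.
rewrite /elementary_op (ltnW m_gt1) le_m m_gt1 andbT /=.
have : 0 < cell [:: x, y, z & s] m.
  by apply: (all_nthP 0 s_pos); case: m m_gt1 le_m.
by case: (ltngtP 1 (cell _ m)).
Qed.

(** * Inversion of the order, and extremal sequences of a given sum *)

Lemma alpha_lt_cons_inv x y s t : alpha_lt (x :: s) (y :: t) ->
  x < y \/ x = y /\ alpha_lt t s.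
Proof.
case=> -[|i] [eq_i lt_i]; first by move: lt_i; rewrite !Al_cons0; left; lia.
have eq_xy : x = y by have := eq_i 0 isT; rewrite !Al_cons0; lia.
right; split=> //; exists i; split=> [j lt_j|].
  by have := eq_i j.+1 lt_j; rewrite !Al_consS; lia.
by move: lt_i; rewrite !Al_consS; lia.
Qed.

Lemma pos_sumn0 u : all (leq 1) u -> sumn u = 0 -> u = [::].
Proof. by case: u => //= x u /andP[]; lia. Qed.

Lemma alpha_max u m : all (leq 1) u -> sumn u = m -> 0 < m ->
  u = [:: m] \/ alpha_lt u [:: m].
Proof.
move=> u_pos <- {m}; case: u u_pos => //= x u /andP[x_gt0 u_pos] _.
have [/(pos_sumn0 u_pos)->|sum_gt0] := posnP (sumn u).
  by left; rewrite addn0.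
by right; apply: alpha_lt_head; lia.
Qed.

(** The least head is [1]; after it the order is reversed, so the least list continues with the
    greatest one of sum [m]. *)
Lemma alpha_min u m : all (leq 1) u -> sumn u = m.+1 -> 0 < m ->
  u = [:: 1; m] \/ alpha_lt [:: 1; m] u.
Proof.
case: u => //= x u /andP[x_gt0 u_pos] sum_u m_gt0.
have [lt_1x|lt_x1|eq_1x] := ltngtP 1 x; [|lia|subst x].
  by right; apply: alpha_lt_head.
case: (@alpha_max u m) => // [|->|lt_u]; [lia|by left|].
by right; apply: alpha_lt_cons.
Qed.

Lemma alpha_max_nlt u m : all (leq 1) u -> sumn u = m -> 0 < m ->
  ~ alpha_lt [:: m] u.
Proof.
move=> u_pos sum_u m_gt0 lt_mu.
case: (alpha_max u_pos sum_u m_gt0) => [eq_u|lt_um].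
  by apply: (@alpha_lt_irr u); rewrite {1}eq_u.
exact: alpha_lt_irr (alpha_lt_trans lt_mu lt_um).
Qed.

Lemma alpha_min_nlt u m : all (leq 1) u -> sumn u = m.+1 -> 0 < m ->
  ~ alpha_lt u [:: 1; m].
Proof.
move=> u_pos sum_u m_gt0 lt_um.
case: (alpha_min u_pos sum_u m_gt0) => [eq_u|lt_mu].
  by apply: (@alpha_lt_irr u); rewrite {2}eq_u.
exact: alpha_lt_irr (alpha_lt_trans lt_um lt_mu).
Qed.

(** * Each step gives the immediate neighbour *)

Lemma pos_sumn1 u : all (leq 1) u -> sumn u = 1 -> u = [:: 1].
Proof.
case: u => //= x u /andP[x_gt0 u_pos] sum_u.
by rewrite (@pos_sumn0 u) //; [congr [:: _]|]; lia.
Qed.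

(** Adjacency in positive form: whatever lies ahead of [s] is [t] or lies ahead of [t]. Quantifying
    over positive lists with the sum of [s], instead of over some [A n], lets it pass to tails. *)
Definition next_in_dir b s t :=
  [/\ all (leq 1) t, sumn t = sumn s, dir_lt b s t &
      forall u, all (leq 1) u -> sumn u = sumn s -> dir_lt b s u ->
        u = t \/ dir_lt b t u].

Lemma next_in_dir_cons b x s t :
  0 < x -> next_in_dir (~~ b) s t -> next_in_dir b (x :: s) (x :: t).
Proof.
move=> x_gt0 [t_pos sum_t lt_st gap].
split=> [||| [|y u]] /=; rewrite ?x_gt0 ?sum_t //; try lia.
  exact: dir_lt_cons.
move=> /andP[y_gt0 u_pos] sum_u lt_u.
(* A different head already puts [y :: u] ahead of every list with head [x]; an equal head leaves a
   comparison of tails, to which [gap] applies. *)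
have [dir_xy|[eq_xy lt_su]] : (if b then y < x else x < y) \/
    x = y /\ dir_lt (~~ b) s u.
- case: b lt_u {lt_st gap} => /alpha_lt_cons_inv [|[-> lt_su]].
  + by left.
  + by right.
  + by left.
  + by right.
- by right; case: b dir_xy {lt_u lt_st gap} => /=; apply: alpha_lt_head.
subst y; have [->|lt_tu] := gap u u_pos (addnI sum_u) lt_su.
  by left.
by right; apply: dir_lt_cons.
Qed.

Lemma step_next b s t :
  all (leq 1) s -> step b s = Some t -> next_in_dir b s t.
Proof.
elim: s b t => [|x s IHs] b t; first by rewrite /step longest_leftE; case: b.
move=> /= /andP[x_gt0 s_pos].
case step_s: (step (~~ b) s) => [t'|].
  rewrite (step_cons x step_s) => -[<-].
  exact: next_in_dir_cons (IHs _ _ s_pos step_s).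
(* The tail is at the end of its direction, so no list with head [x] and the same sum lies ahead:
   the neighbour has head [x - 1] when descending and [x + 1] when ascending. *)
case: b step_s => /(step_eq_None s_pos) /=.
- case=> [->|[m eq_s]].
    rewrite /step longest_leftE /elementary_op /cell /=.
    case: (ltngtP 1 x) x_gt0 => // x_gt1 _.
    case=> <-; rewrite /splitting /cell /=.
    split=> [|||[|y u]] /=; try lia.
      by apply: alpha_lt_head; lia.
    move=> /andP[y_gt0 u_pos] sum_u /alpha_lt_cons_inv[lt_yx|[eq_yx lt_u]].
      have [lt_y|ge_y] := ltnP y x.-1.
        by right; apply: alpha_lt_head.
      by left; rewrite (@pos_sumn1 u) //; [congr [:: _; _]|]; lia.
    have eq_u : u = [::] by apply: pos_sumn0 => //; lia.
    by subst u; case: (alpha_lt_irr lt_u).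
  (* [[:: x; m]] becomes [[:: x.-1; 1; m]]: the greatest list with head [x.-1] carries the least
     tail of sum [m.+1]. *)
  move: s_pos; rewrite eq_s /= andbT => m_gt0.
  rewrite /step longest_leftE /elementary_op /cell /=.
  case: (ltngtP 1 x) x_gt0 => // x_gt1 _.
  case=> <-; rewrite /splitting /cell /=.
  split=> [|||[|y u]] /=; try lia.
    by apply: alpha_lt_head; lia.
  move=> /andP[y_gt0 u_pos] sum_u /alpha_lt_cons_inv[lt_yx|[eq_yx lt_u]].
    have [lt_y|ge_y] := ltnP y x.-1; first by right; apply: alpha_lt_head.
    have ->: y = x.-1 by lia.
    case: (@alpha_min u m) => // [|->|lt_u]; [lia|by left|].
    by right; apply: alpha_lt_cons.
  by case: (@alpha_max_nlt u m) => //; lia.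
(* For an empty tail the list has no even cell, so the step is undefined and the case closes at
   once. *)
case=> [->|->|[m m_gt0 ->]];
  rewrite /step longest_leftE /elementary_op /cell //=.
- case=> <-; rewrite /conjugation /cell /=.
  split=> [|||[|y u]] /=; try lia.
    by apply: alpha_lt_head.
  move=> /andP[y_gt0 u_pos] sum_u /alpha_lt_cons_inv[lt_xy|[eq_xy lt_u]].
    by left; rewrite (@pos_sumn0 u) //; [congr [:: _]|]; lia.
  have eq_u : u = [:: 1] by apply: pos_sumn1 => //; lia.
  by subst u; case: (alpha_lt_irr lt_u).
(* [[:: x; 1; m]] becomes [[:: x.+1; m]]: the least list with head [x.+1] carries the greatest tail
   of sum [m]. *)
- case=> <-; rewrite /conjugation /cell /=.
  split=> [|||[|y u]] /=; try lia.
    by apply: alpha_lt_head.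
  move=> /andP[y_gt0 u_pos] sum_u /alpha_lt_cons_inv[lt_xy|[eq_xy lt_u]].
    have [lt_y|le_y] := ltnP x.+1 y; first by right; apply: alpha_lt_head.
    have ->: y = x.+1 by lia.
    case: (@alpha_max u m) => // [|->|lt_u]; [lia|by left|].
    by right; apply: alpha_lt_cons.
  by case: (@alpha_min_nlt u m) => //; lia.
Qed.

(** * Finiteness, endpoints and termination *)

Lemma enum_pos_sumn n :
  exists L : seq (seq nat), forall s, all (leq 1) s -> sumn s <= n -> s \in L.
Proof.
elim: n => [|n [L L_full]].
  exists [:: [::]] => s s_pos; rewrite leqn0 => /eqP sum_s.
  by rewrite (pos_sumn0 s_pos sum_s).
exists ([::] :: [seq y :: t | y <- iota 0 n.+2, t <- L]) => -[//|x s].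
move=> /andP[x_gt0 s_pos]; rewrite [sumn _]/= => sum_s.
rewrite inE; apply/orP; right.
apply/allpairsP; exists (x, s); rewrite mem_iota L_full //=.
  by split=> //; lia.
by lia.
Qed.

Definition extremum (n : nat) (b : bool) : seq nat :=
  if b then [:: 1; n - 1] else [:: n].

Lemma mem_A n s : 0 < n -> (s \in A n) = all (leq 1) s && (sumn s == n).
Proof. by rewrite inE /= /alpha_seq; case: s => //=; case: n. Qed.

Lemma extremum_mem n b : 2 <= n -> extremum n b \in A n.
Proof. by case: b => n_gt1; rewrite mem_A /=; lia. Qed.

Lemma extremum_ge n b s : 2 <= n -> s \in A n -> s <> extremum n b ->
  dir_lt b s (extremum n b).
Proof.
move=> n_gt1; rewrite mem_A; last lia.
case/andP=> s_pos /eqP sum_s; case: b => /= neq_s.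
  by case: (@alpha_min s (n - 1)) => //; lia.
by case: (@alpha_max s n) => //; lia.
Qed.

Lemma extremum_nlt n b s : 2 <= n -> s \in A n -> ~ dir_lt b (extremum n b) s.
Proof.
move=> n_gt1 sA lt_es; have [eq_s|/eqP neq_s] := eqVneq s (extremum n b).
  by apply: (@dir_lt_irr b s); rewrite {1}eq_s.
apply: (@dir_lt_irr b s).
exact: dir_lt_trans (extremum_ge n_gt1 sA neq_s) lt_es.
Qed.

(** Among the lists without a step, [[::]] and [[:: 1]] have sum below 2, and any other one of sum
    [n] is the extremum itself. *)
Lemma step_neq_extremum n b s : 2 <= n -> s \in A n -> s <> extremum n b ->
  exists t, step b s = Some t.
Proof.
move=> n_gt1; rewrite mem_A; last lia.
case/andP=> s_pos /eqP sum_s neq_s.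
case step_s: (step b s) => [t|]; first by exists t.
case: b neq_s step_s => neq_s /(step_eq_None s_pos) /=.
  case=> [eq_s|eq_s|[m m_gt0 eq_s]]; move: sum_s; rewrite eq_s /=; try lia.
  by move=> sum_m; case: neq_s; rewrite eq_s /=; congr [:: _; _]; lia.
case=> [eq_s|[m eq_s]]; move: sum_s; rewrite eq_s /=; first lia.
by move=> sum_m; case: neq_s; rewrite eq_s /=; congr [:: _]; lia.
Qed.

Definition dir_adjacent n b s t :=
  if b then adjacent (A n) t s else adjacent (A n) s t.

Lemma next_adjacent n b s t : 2 <= n -> s \in A n -> next_in_dir b s t ->
  t \in A n /\ dir_adjacent n b s t.
Proof.
move=> n_gt1 sA [t_pos sum_t lt_st gap].
have tA : t \in A n by move: sA; rewrite !mem_A ?sum_t ?t_pos; lia.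
split=> //.
have no_u u : u \in A n -> dir_lt b s u -> dir_lt b u t -> False.
  move=> uA lt_su lt_ut; move: uA sA.
  rewrite !mem_A; [|lia|lia] => /andP[u_pos /eqP sum_u] /andP[_ /eqP sum_s].
  have [eq_u|lt_tu] := gap u u_pos (etrans sum_u (esym sum_s)) lt_su.
    by apply: (@dir_lt_irr b t); rewrite -{1}eq_u.
  exact: dir_lt_irr (dir_lt_trans lt_tu lt_ut).
by case: b lt_st no_u {gap} => /= lt_st no_u; split=> // -[u [uA lt1 lt2]];
  apply: (no_u u).
Qed.

Lemma Forall_mem (T : eqType) (P : T -> Prop) (r : seq T) :
  (forall u, u \in r -> P u) -> List.Forall P r.
Proof.
elim: r => [|x r IHr] Pr; constructor; first by apply: Pr; rewrite mem_head.
by apply: IHr => u ur; apply: Pr; rewrite inE ur orbT.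
Qed.

(* The elements still ahead of s all lie in L, and removing each new element
   from L makes its size the termination measure. *)
Lemma produces_dir n b (L : seq (seq nat)) s : 2 <= n -> s \in A n ->
  (forall u, u \in A n -> dir_lt b s u -> u \in L) ->
  exists r,
    [/\ produces (step b) (extremum n b) s r,
        forall u, u \in r <-> u \in A n /\ dir_lt b s u,
        StronglySorted (dir_lt b) r &
        Sorted (dir_adjacent n b) (s :: r)].
Proof.
move=> n_gt1; have [k] := ubnP (size L).
elim: k L s => // k IHk L s lt_L sA L_full.
have [eq_s|/eqP neq_s] := eqVneq s (extremum n b).
  exists [::]; rewrite eq_s; split; try by constructor.
    by move=> u; split=> // -[uA /(extremum_nlt n_gt1 uA)].
have [t step_s] := step_neq_extremum n_gt1 sA neq_s.
have s_pos : all (leq 1) s by move: sA; rewrite mem_A; [case/andP|lia].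
have next_t := step_next s_pos step_s.
have [tA adj_st] := next_adjacent n_gt1 sA next_t.
have [_ _ lt_st gap] := next_t.
have tL := L_full t tA lt_st.
case: (IHk (rem t L) t) => // [|u uA lt_tu|r [prod_r mem_r sorted_r adj_r]].
- by move: lt_L; rewrite size_rem //; case: L tL {L_full} => //= *; lia.
(* Nothing ahead of [t] is lost by removing [t] from [L], since [t] is not ahead of itself. *)
- have neq_ut : u != t.
    by apply/eqP=> eq_u; apply: (@dir_lt_irr b t); rewrite -{2}eq_u.
  have := L_full u uA (dir_lt_trans lt_st lt_tu).
  by rewrite (perm_mem (perm_to_rem tL)) inE (negPf neq_ut).
exists (t :: r); split.
- exact: produces_step step_s prod_r.
- move=> u; rewrite inE; split=> [/orP[/eqP->//|/mem_r[uA lt_tu]]|[uA lt_su]].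
    by split=> //; apply: dir_lt_trans lt_st lt_tu.
  (* By [gap], what lies ahead of [s] is [t] together with what lies ahead of [t], and the latter is
     listed by [r]. *)
  move: (uA) sA; rewrite !mem_A; [|lia|lia].
  case/andP=> u_pos /eqP sum_u /andP[_ /eqP sum_s].
  have [->|lt_tu] := gap u u_pos (etrans sum_u (esym sum_s)) lt_su.
  + by apply/orP; left; apply/eqP.
  + by apply/orP; right; apply/mem_r.
- by apply: SSorted_cons => //; apply: Forall_mem => u /mem_r[].
- by constructor => //; apply: HdRel_cons.
Qed.

Lemma produces_all n b s : 2 <= n -> s \in A n ->
  exists r,
    [/\ produces (step b) (extremum n b) s r,
        forall u, u \in r <-> u \in A n /\ dir_lt b s u,
        StronglySorted (dir_lt b) r &
        Sorted (dir_adjacent n b) (s :: r)].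
Proof.
move=> n_gt1 sA; have [L L_full] := enum_pos_sumn n.
apply: (produces_dir (L := L)) => // u; rewrite mem_A; last lia.
by case/andP=> u_pos /eqP sum_u _; apply: L_full => //; lia.
Qed.


Theorem mainTheorem2 (n : nat) (hn : 2 <= n) :
  [/\ [:: n] \in A n &
      forall beta : seq nat,
        beta \in A n -> beta <> [:: n] -> alpha_lt beta [:: n]] /\
  [/\ [:: 1; n - 1] \in A n &
      forall beta : seq nat,
        beta \in A n -> beta <> [:: 1; n - 1] ->
        alpha_lt [:: 1; n - 1] beta] /\
  forall alpha : seq nat, alpha \in A n ->
  exists up down : seq (seq nat),
    [/\ produces (step false) [:: n] alpha up,
        (forall beta : seq nat,
           beta \in up <-> beta \in A n /\ alpha_lt alpha beta),
        StronglySorted alpha_lt up &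
        Sorted (fun s t => adjacent (A n) s t) (alpha :: up)] /\
    [/\ produces (step true) [:: 1; n - 1] alpha down,
        (forall beta : seq nat,
           beta \in down <-> beta \in A n /\ alpha_lt beta alpha),
        StronglySorted alpha_gt down &
        Sorted (fun s t => adjacent (A n) t s) (alpha :: down)] /\
    (forall beta : seq nat,
       beta \in A n <-> beta \in rev down ++ alpha :: up).
Proof.
split.
  split=> [|beta]; first exact: (extremum_mem false).
  exact: (@extremum_ge n false).
split.
  split=> [|beta]; first exact: (extremum_mem true).
  exact: (@extremum_ge n true).
move=> alpha alphaA.
have [up [prod_up mem_up sorted_up adj_up]] := produces_all false hn alphaA.
have [down [prod_down mem_down sorted_down adj_down]] :=
  produces_all true hn alphaA.
exists up, down; split=> //; split=> // beta.
rewrite mem_cat mem_rev in_cons; split=> [betaA|].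
  (* Totality of the order sorts each [beta] into the predecessors of [alpha], [alpha] itself or its
     successors. *)
  move: (alphaA) (betaA); rewrite !(mem_A _ (ltnW hn)).
  case/andP=> alpha_pos /eqP sum_alpha /andP[beta_pos /eqP sum_beta].
  have eq_sum := etrans sum_alpha (esym sum_beta).
  have [->|lt_ab|lt_ba] := alpha_lt_total alpha_pos beta_pos eq_sum.
  - by rewrite eqxx orbT.
  - by apply/or3P; constructor 3; apply/mem_up.
  - by apply/or3P; constructor 1; apply/mem_down.
by case/or3P=> [/mem_down[]|/eqP->|/mem_up[]].
Qed.
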